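(* Let $\epsilon\in(0,1/2)$, $\epsilon_t=\epsilon/d$ for $1\le t\le d$, and let $t\le d$ and $k\le K$ be such that $$\mathcal{SV}_{tk}(R_k)\le-\tfrac12\mathrm{ErfInv}^2(\epsilon).$$ Let $\rho_{tk}^*\in(0,R_k)$ be such that $\mathcal{SV}_{tk}(\rho^*_{tk})=-\frac12\mathrm{ErfInv}^2(\epsilon)$, and let a real $\chi$ satisfy $\chi>\underline\chi$, where $$\underline\chi=\begin{cases}\frac12\left[1+\frac{\mathrm{ErfInv}(\epsilon/(Kd))}{\mathrm{ErfInv}(\epsilon)}\right],&\text{Gaussian case, }\mathcal U\text{ contains a }\succeq\text{-largest element},\\[2mm]\left(\frac12\left[1+\frac{\mathrm{ErfInv}(\epsilon/(Kd))}{\mathrm{ErfInv}(\epsilon)}\right]\right)^2,&\text{Gaussian case, }\mathcal U\text{ does not contain a }\succeq\text{-largest element},\\[2mm]\frac{\ln(Kd/\epsilon^2)}{\mathrm{ErfInv}^2(\epsilon)},&\text{sub-Gaussian case.}\end{cases}$$ Then, whenever the input is a feasible signal of shape $k$ and magnitude at least $\chi\rho_{tk}^*$ (that is, the input belongs to $X_k^\rho$ for some $\rho\ge\chi\rho^*_{tk}$), the probability that the inference procedure (Procedure SG of the context in the sub-Gaussian case, Procedure G of the context in the Gaussian case) terminates with the signal conclusion at time $t$ or earlier is at least $1-\epsilon$.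
   Context: **Notation.** $\mathbf S^m$ is the space of real symmetric $m\times m$ matrices, $\mathbf S^m_+$ the cone of positive semidefinite ones, $A\succeq B$ means $A-B\in\mathbf S^m_+$. A $\succeq$-largest element of $\mathcal U$ is $\overline\Theta\in\mathcal U$ with $\overline\Theta\succeq\Theta$ for all $\Theta\in\mathcal U$. A Borel probability distribution $P$ on $\mathbf R^m$ is sub-Gaussian with parameters $(u,\Theta)$ if $\ln\int e^{h^Ty}P(dy)\le u^Th+\frac12h^T\Theta h$ for all $h\in\mathbf R^m$. $\mathrm{Erf}(s)=\frac1{\sqrt{2\pi}}\int_s^\infty e^{-r^2/2}dr$, and $\mathrm{ErfInv}(\kappa)=\min\{r:\mathrm{Erf}(r)\le\kappa\}$ for $0<\kappa\le1/2$, $\mathrm{ErfInv}(\kappa)=0$ for $1/2\le\kappa<\infty$; by convention $\mathrm{ErfInv}(\epsilon_t/0):=0$. **Observations.** An unknown deterministic input $x\in\mathbf R^n$ is observed through $y^t=\bar A_tx+\xi^t=S_t[\bar A_dx+\xi^d]\in\mathbf R^{\nu_t}$, $t=1,\dots,d$, where $1\le\nu_1\le\dots\le\nu_d$, $\bar A_d$ is a given $\nu_d\times n$ matrix, $S_t$ is a given $\nu_t\times\nu_d$ matrix of rank $\nu_t$ ($S_d=I$), $S_{t-1}=R_tS_t$ for some matrix $R_t$, $\bar A_t=S_t\bar A_d$, $\xi^t=S_t\xi^d$, and $\xi^d$ is random noise. $\mathcal U$ is a given nonempty convex compact subset of $\mathrm{int}\,\mathbf S^{\nu_d}_+$, and $\mathcal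 U_t=\{S_t\Theta S_t^T:\Theta\in\mathcal U\}$. *Sub-Gaussian case*: $\xi^d$ is sub-Gaussian with parameters $(0,\Theta)$ for some $\Theta\in\mathcal U$. *Gaussian case*: $\xi^d\sim\mathcal N(0,\Theta)$ for some $\Theta\in\mathcal U$. **Inputs.** $X\subset\mathbf R^n$ is a convex compact set; the set of feasible nuisances $N\subset X$ is closed and convex with $0\in N$. For $k=1,\dots,K$: $W_k\subset\mathbf R^n$ is a nonempty closed convex set with $0\notin W_k$ and $\rho w\in W_k$ whenever $w\in W_k$, $\rho\ge1$; $V_k\subset X$ is a nonempty compact convex set with $0\in V_k$. For $\rho>0$, $W_k^\rho=\{\rho y:y\in W_k\}$ and $X_k^\rho=[V_k+W_k^\rho]\cap X$ (feasible signals of shape $k$ and magnitude $\ge\rho$). It is assumed that for every $k$ the set $X_k^\rho$ is nonempty for some $\rho>0$; $R_k>0$ denotes the largest $\rho$ for which $X_k^\rho\neq\emptyset$. **Saddle point values.** Let $N^t=\bar A_tN$, $U^t_{k\rho}=\{\bar A_tx:x\in X_k^\rho\}$, and for $\rho\in(0,R_k]$ $$\mathcal{SV}_{tk}(\rho)=\min_{h\in\mathbf R^{\nu_t}}\ \max_{\theta_1\in N^t,\ \theta_2\in U^t_{k\rho},\ \Theta\in\mathcal U_t}\left[\tfrac12h^T[\theta_2-\theta_1]+\tfrac12h^T\Theta h\right].$$ A saddle point $(h_{tk\rho};\theta^1_{tk\rho},\theta^2_{tk\rho},\Theta_{tk\rho})$ exists; the associated affine detector is $\phi_{tk\rho}(y^t)=h_{tk\rho}^T\left[y^t-\tfrac12(\theta^1_{tk\rho}+\theta^2_{tk\rho})\right]$.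 **Procedure SG.** For $\varkappa\in(0,1]$ let $\mathcal K_t(\varkappa)=\{k\le K:\mathcal{SV}_{tk}(R_k)<\ln\varkappa\}$, $K_t(\varkappa)=\mathrm{Card}\,\mathcal K_t(\varkappa)$, $\varkappa_t=\sup\{\varkappa\in(0,1]:K_t(\varkappa)\le\epsilon\epsilon_t/\varkappa^2\}$. For $k\in\mathcal K_t(\varkappa_t)$ let $\rho_{tk}\in(0,R_k)$ be such that $\mathcal{SV}_{tk}(\rho_{tk})=\ln\varkappa_t$ and set $\phi_{tk}=\phi_{tk\rho_{tk}}$; for other $k$ set $\rho_{tk}=+\infty$. The threshold at step $t$ is $\alpha_t=\ln(\varkappa_t/\epsilon)$. **Procedure G.** For $\delta\ge0$ let $\mathcal L_t(\delta)=\{k\le K:\mathcal{SV}_{tk}(R_k)<-\frac12\delta^2\}$, $L_t(\delta)=\mathrm{Card}\,\mathcal L_t(\delta)$, $\delta_t=\inf\{\delta\ge0:\delta\ge\frac12[\mathrm{ErfInv}(\epsilon_t/L_t(\delta))+\mathrm{ErfInv}(\epsilon)]\}$. For $k\in\mathcal L_t(\delta_t)$ let $\rho_{tk}\in(0,R_k]$ be such that $\mathcal{SV}_{tk}(\rho_{tk})=-\frac12\delta_t^2$ and set $\phi_{tk}=\phi_{tk\rho_{tk}}$; for other $k$ set $\rho_{tk}=+\infty$. The threshold at step $t$ is $\alpha_t=\frac{\delta_t}2[\mathrm{ErfInv}(\epsilon)-\mathrm{ErfInv}(\epsilon_t/L_t(\delta_t))]$. **Both procedures.** At step $t$, given $y^t$: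 if there is $k$ with $\rho_{tk}<\infty$ and $\phi_{tk}(y^t)<\alpha_t$, the procedure claims that the input is a signal and terminates (signal conclusion at time $t$); otherwise it passes to time $t+1$ (if $t<d$) or terminates without a signal conclusion (if $t=d$). *)

(* Defs.v *)
From HB Require Import structures.
From mathcomp Require Import all_boot all_order all_algebra.
From mathcomp Require Import all_classical all_reals all_analysis.

Set Implicit Arguments.
Unset Strict Implicit.
Unset Printing Implicit Defensive.

Import Order.TTheory GRing.Theory Num.Theory.
Import numFieldNormedType.Exports.

Local Open Scope classical_set_scope.
Local Open Scope ring_scope.

Section Preliminaries.
Context {R : realType}.

Definition dotv m (g h : 'cV[R]_m) : R := (g^T *m h) 0 0.

Definition qform m (Theta : 'M[R]_m) (h : 'cV[R]_m) : R :=
  (h^T *m Theta *m h) 0 0.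

Definition symm m : set 'M[R]_m := [set A | A^T = A].

Definition psd m : set 'M[R]_m :=
  [set A | symm A /\ forall h : 'cV[R]_m, 0 <= qform A h].

(* The interior is relative to the space of symmetric matrices; in the space of
   all square matrices psd has empty interior as soon as m > 1. *)
Definition int_psd m : set 'M[R]_m :=
  [set A | symm A /\ \forall B \near within (@symm m) (nbhs A), psd B].

Definition has_largest m (U : set 'M[R]_m) : Prop :=
  exists Tb, U Tb /\ forall Theta, U Theta -> psd (Tb - Theta).

(* Gaussian tail probability *)
Definition Erf (s : R) : R :=
  (Num.sqrt (2 * pi))^-1 *
  \int[lebesgue_measure]_(r in `[s, +oo[) expR (- (r ^+ 2 / 2)).

(* Only meaningful for kappa > 0; for such kappa the infimum is attained. *)
Definition ErfInv (kappa : R) : R :=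
  if kappa <= 1 / 2 then inf [set r | Erf r <= kappa] else 0.

(* ErfInv (e / L) with the convention ErfInv (e / 0) = 0 *)
Definition ErfInvDiv (e : R) (L : nat) : R :=
  if L == 0%N then 0 else ErfInv (e / L%:R).

Section Noise.
Context {d0 : measure_display} {Omega : measurableType d0}.
Variables (P : probability Omega R) (m : nat) (xi : 'I_m -> {RV P >-> R}).

Definition rvec (w : Omega) : 'cV[R]_m := \col_i xi i w.

Definition sub_gaussian (u : 'cV[R]_m) (Theta : 'M[R]_m) : Prop :=
  forall h : 'cV[R]_m,
    (lne 'E_P[fun w => expR (dotv h (rvec w))]
     <= (dotv u h + 1 / 2 * qform Theta h)%:E)%E.

(* One-dimensional normal law with mean mu and variance v, v = 0 being the
   Dirac mass (the library's normal_prob mu 0 is not degenerate). *)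
Definition normal_law (mu v : R) : set R -> \bar R :=
  if v == 0 then \d_mu else normal_prob mu (Num.sqrt v).

(* Multivariate N(u, Theta): every linear form h^T xi is (possibly degenerate)
   normal with mean h^T u and variance h^T Theta h. *)
Definition gaussian (u : 'cV[R]_m) (Theta : 'M[R]_m) : Prop :=
  forall (h : 'cV[R]_m) (B : set R), measurable B ->
    P [set w | B (dotv h (rvec w))] = normal_law (dotv h u) (qform Theta h) B.

End Noise.
End Preliminaries.

(* Stages are the naturals 1, ..., stages; the values of nu, sens and of all
   stage-indexed objects below are irrelevant outside this range. *)
Record problem (R : realType) := Problem {
  input_dim : nat;                                  (* n *)
  stages : nat;                                     (* d *)
  shapes : nat;                                     (* K *)
  nu : nat -> nat;                                  (* nu_t *)
  Abar_last : 'M[R]_(nu stages, input_dim);         (* \bar A_d *)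
  sens : forall t : nat, 'M[R]_(nu t, nu stages);   (* S_t *)
  covs : set 'M[R]_(nu stages);                     (* \mathcal U *)
  inputs : set 'cV[R]_input_dim;                    (* X *)
  nuis : set 'cV[R]_input_dim;                      (* N *)
  acts : 'I_shapes -> set 'cV[R]_input_dim;         (* W_k *)
  shifts : 'I_shapes -> set 'cV[R]_input_dim        (* V_k *)
}.

Arguments covs {R} p _.
Arguments inputs {R} p _.
Arguments nuis {R} p _.

Section Procedures.
Context {R : realType}.
Variable p : problem R.

Local Notation n := (input_dim p).
Local Notation d := (stages p).
Local Notation K := (shapes p).

Implicit Types (t : nat) (k : 'I_K) (rho : R).

Definition signals k rho : set 'cV[R]_n :=
  [set v + y | v in shifts k & y in [set rho *: w | w in acts k]] `&` inputs p.

(* Largest magnitude R_k; by compactness the supremum is a maximum. *)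
Definition Rmax k : R := sup [set rho | 0 < rho /\ signals k rho !=set0].

Record standing_assumptions : Prop := {
  nu_pos : forall t, (1 <= t <= d)%N -> (1 <= nu p t)%N;
  nu_mono : forall t, (1 <= t)%N -> (t < d)%N -> (nu p t <= nu p t.+1)%N;
  sens_rank : forall t, (1 <= t <= d)%N -> \rank (sens p t) = nu p t;
  sens_last : sens p d = 1%:M;
  sens_factor : forall t, (1 <= t)%N -> (t < d)%N ->
    exists Rt : 'M[R]_(nu p t, nu p t.+1), sens p t = Rt *m sens p t.+1;
  covs_nonempty : covs p !=set0;
  covs_convex : @convex_set R 'M[R]_(nu p d) (covs p);
  covs_compact : compact (covs p);
  covs_int : covs p `<=` @int_psd R (nu p d);
  inputs_convex : @convex_set R 'cV[R]_n (inputs p);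
  inputs_compact : compact (inputs p);
  nuis_sub : nuis p `<=` inputs p;
  nuis_closed : closed (nuis p);
  nuis_convex : @convex_set R 'cV[R]_n (nuis p);
  nuis_0 : nuis p 0;
  acts_nonempty : forall k, acts k !=set0;
  acts_closed : forall k, closed (acts k);
  acts_convex : forall k, @convex_set R 'cV[R]_n (acts k);
  acts_not0 : forall k, ~ acts k 0;
  acts_scale : forall k w (r : R), acts k w -> 1 <= r -> acts k (r *: w);
  shifts_sub : forall k, shifts k `<=` inputs p;
  shifts_nonempty : forall k, shifts k !=set0;
  shifts_compact : forall k, compact (shifts k);
  shifts_convex : forall k, @convex_set R 'cV[R]_n (shifts k);
  shifts_0 : forall k, shifts k 0;
  signals_nonempty : forall k, exists2 rho : R, 0 < rho & signals k rho !=set0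
}.

Definition Abar t : 'M[R]_(nu p t, n) := sens p t *m Abar_last p.

(* y^t for the input x and the value z of the noise xi^d *)
Definition obs (x : 'cV[R]_n) (z : 'cV[R]_(nu p d)) t : 'cV[R]_(nu p t) :=
  sens p t *m (Abar_last p *m x + z).

Definition nuis_at t : set 'cV[R]_(nu p t) := [set Abar t *m x | x in nuis p].

Definition signals_at t k rho : set 'cV[R]_(nu p t) :=
  [set Abar t *m x | x in signals k rho].

Definition covs_at t : set 'M[R]_(nu p t) :=
  [set sens p t *m Theta *m (sens p t)^T | Theta in covs p].

Arguments nuis_at t _ : clear implicits.
Arguments signals_at t k rho _ : clear implicits.
Arguments covs_at t _ : clear implicits.

Definition payoff m (h th1 th2 : 'cV[R]_m) (Theta : 'M[R]_m) : R :=
  1 / 2 * dotv h (th2 - th1) + 1 / 2 * qform Theta h.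

(* The infimum and, for 0 < rho <= Rmax k, the suprema are attained. *)
Definition SV t k rho : \bar R :=
  ereal_inf [set ereal_sup [set z | exists th1 th2 Theta,
      [/\ nuis_at t th1, signals_at t k rho th2, covs_at t Theta
        & z = (payoff h th1 th2 Theta)%:E]]
    | h in [set: 'cV[R]_(nu p t)]].

Definition saddle_point t k rho (h th1 th2 : 'cV[R]_(nu p t))
    (Theta : 'M[R]_(nu p t)) : Prop :=
  [/\ nuis_at t th1, signals_at t k rho th2, covs_at t Theta,
      (forall th1' th2' Theta',
         nuis_at t th1' -> signals_at t k rho th2' -> covs_at t Theta' ->
         payoff h th1' th2' Theta' <= payoff h th1 th2 Theta)
    & (forall h', payoff h th1 th2 Theta <= payoff h' th1 th2 Theta)].

(* The magnitudes rho_tk, possibly +oo, and the saddle points defining the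
   detectors phi_tk; the latter are irrelevant when rho_tk = +oo. *)
Record detectors := Detectors {
  mag : nat -> 'I_K -> \bar R;
  dir : forall t : nat, 'I_K -> 'cV[R]_(nu p t);
  theta1 : forall t : nat, 'I_K -> 'cV[R]_(nu p t);
  theta2 : forall t : nat, 'I_K -> 'cV[R]_(nu p t);
  theta_cov : forall t : nat, 'I_K -> 'M[R]_(nu p t)
}.

Definition phi (D : detectors) t k (y : 'cV[R]_(nu p t)) : R :=
  dotv (dir D t k) (y - (1 / 2) *: (theta1 D t k + theta2 D t k)).

Definition saddle_at (D : detectors) t k rho : Prop :=
  saddle_point k rho (dir D t k) (theta1 D t k) (theta2 D t k)
    (theta_cov D t k).

Variables (eps : R) (epst : nat -> R).

Definition cardK t (kap : R) : nat :=
  #|[pred k : 'I_K | (SV t k (Rmax k) < (ln kap)%:E)%E]|.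

Definition kap_SG t : R :=
  sup [set kap | 0 < kap <= 1 /\ (cardK t kap)%:R <= eps * epst t / kap ^+ 2].

Definition alpha_SG t : R := ln (kap_SG t / eps).

Definition detectors_SG (D : detectors) : Prop :=
  forall t k, (1 <= t <= d)%N ->
    if (SV t k (Rmax k) < (ln (kap_SG t))%:E)%E then
      exists rho, [/\ mag D t k = rho%:E, 0 < rho < Rmax k,
        SV t k rho = (ln (kap_SG t))%:E & saddle_at D t k rho]
    else mag D t k = +oo%E.

Definition cardL t (delta : R) : nat :=
  #|[pred k : 'I_K | (SV t k (Rmax k) < (- (1 / 2 * delta ^+ 2))%:E)%E]|.

Definition delta_G t : R :=
  inf [set delta | 0 <= delta /\
    1 / 2 * (ErfInvDiv (epst t) (cardL t delta) + ErfInv eps) <= delta].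

Definition alpha_G t : R :=
  delta_G t / 2 * (ErfInv eps - ErfInvDiv (epst t) (cardL t (delta_G t))).

Definition detectors_G (D : detectors) : Prop :=
  forall t k, (1 <= t <= d)%N ->
    if (SV t k (Rmax k) < (- (1 / 2 * delta_G t ^+ 2))%:E)%E then
      exists rho, [/\ mag D t k = rho%:E, 0 < rho <= Rmax k,
        SV t k rho = (- (1 / 2 * delta_G t ^+ 2))%:E & saddle_at D t k rho]
    else mag D t k = +oo%E.

Definition claims (D : detectors) (alpha : nat -> R) t
    (y : 'cV[R]_(nu p t)) : Prop :=
  exists k, (mag D t k < +oo)%E /\ phi D k y < alpha t.

(* The procedure stops at its first claim, so the signal conclusion is made at
   time t when stage t is reached without a claim and a claim is made there. *)
Definition conclusion_at (D : detectors) (alpha : nat -> R)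
    (y : forall t, 'cV[R]_(nu p t)) t : Prop :=
  (forall s, (1 <= s)%N -> (s < t)%N -> ~ claims D alpha (y s)) /\
  claims D alpha (y t).

Definition conclusion_by (D : detectors) (alpha : nat -> R)
    (y : forall t, 'cV[R]_(nu p t)) t : Prop :=
  exists s, (1 <= s <= t)%N /\ conclusion_at D alpha y s.

End Procedures.

Inductive noise_case := SubGaussianCase | GaussianCase.

Section Cases.
Context {R : realType}.
Variables (c : noise_case) (p : problem R) (eps : R) (epst : nat -> R).

Definition noise_model {d0 : measure_display} {Omega : measurableType d0}
    (P : probability Omega R) (xi : 'I_(nu p (stages p)) -> {RV P >-> R}) :
    Prop :=
  exists Theta, covs p Theta /\
    match c with
    | SubGaussianCase => sub_gaussian xi 0 Theta
    | GaussianCase => gaussian xi 0 Theta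
    end.

Definition valid_detectors (D : detectors p) : Prop :=
  match c with
  | SubGaussianCase => detectors_SG eps epst D
  | GaussianCase => detectors_G eps epst D
  end.

Definition threshold (t : nat) : R :=
  match c with
  | SubGaussianCase => alpha_SG p eps epst t
  | GaussianCase => alpha_G p eps epst t
  end.

Definition chi_low : R :=
  let Kd := (shapes p)%:R * (stages p)%:R in
  let ratio := 1 / 2 * (1 + ErfInv (eps / Kd) / ErfInv eps) in
  match c with
  | SubGaussianCase => ln (Kd / eps ^+ 2) / ErfInv eps ^+ 2
  | GaussianCase => if `[< has_largest (covs p) >] then ratio else ratio ^+ 2
  end.

End Cases.

(* Main.v *)
Require Import Defs.
From mathcomp Require Import all_boot all_order all_algebra.
From mathcomp Require Import all_classical all_reals all_analysis.
From mathcomp Require Import measurable_realfun ring lra.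

Set Implicit Arguments.
Unset Strict Implicit.
Unset Printing Implicit Defensive.

Import Order.TTheory GRing.Theory Num.Theory.
Import numFieldNormedType.Exports.

Local Open Scope classical_set_scope.
Local Open Scope ring_scope.

(* Restricting the maximum to signals and nuisances shrunk by the factor 1/c and
   rescaling h gives SV (c rho) <= c^2 SV (rho) for c >= 1, a bound which serves
   all three cases.  Write rho' for rho_tk^*.  The lower bound on chi puts
   SV (chi rho') strictly below the level which defines rho_tk, so that
   rho_tk < chi rho' and the input is a signal of magnitude rho_tk.  The saddle
   point inequalities bound the drift and the variance of the detector phi_tk at
   such an input, and the Chernoff bound (resp. the Gaussian tail, h being
   stationary at the saddle point) makes the probability of phi_tk >= alpha_t
   at most eps. *)

(** * Tail function of the standard normal law *)

Section GaussianTail.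
Context {R : realType}.
Implicit Types (r s e : R).

Lemma normal_tailE s : normal_prob 0 1 `[s, +oo[ = (Erf s)%:E.
Proof.
have finN : normal_prob 0 1 `[s, +oo[ \is a fin_num by exact: fin_num_measure.
pose c : R := (Num.sqrt (2 * pi))^-1.
have c0 : 0 < c by rewrite invr_gt0 sqrtr_gt0 mulr_gt0 ?pi_gt0.
have E : normal_prob 0 1 `[s, +oo[ =
    (c%:E * \int[lebesgue_measure]_(r in `[s, +oo[) (expR (- (r ^+ 2 / 2)))%:E)%E.
  rewrite -ge0_integralZl//=; first last.
  - by rewrite lee_fin ltW.
  - apply/measurable_EFinP/measurable_funTS; apply: measurableT_comp => //.
    by apply: measurableT_comp => //; apply: measurable_funM.
  apply: eq_integral => x _; rewrite normal_pdfE ?oner_neq0// -EFinM.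
  congr (_ * _)%:E; first by rewrite /normal_peak /c expr1n mul1r mulr_natl.
  by rewrite /normal_fun subr0 expr1n mulNr.
rewrite /Erf /Rintegral -/c EFinM fineK//.
(* The real-valued integral in [Erf] is faithful only if the integral is finite; an infinite one,
   times c > 0, would contradict [finN]. *)
move: finN; rewrite E; move: (integral _ _ _) => [z| |]//.
  by rewrite mulry gtr0_sg// mul1e.
by rewrite mulrNy gtr0_sg// mul1e.
Qed.

Lemma normal_pdf01_le1 x : normal_pdf 0 1 x <= 1 :> R.
Proof.
apply: (le_trans (normal_pdf_ub _ _ (oner_neq0 _))).
have p2 := pi_ge2 R.
rewrite /normal_peak expr1n mul1r invf_le1; last by rewrite sqrtr_gt0; lra.
by rewrite -[leLHS]sqrtr1 ler_wsqrtr//; lra.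
Qed.

(** The normal density is at most 1. This continuity of [Erf] makes the infimum in [ErfInv]
    attained. *)
Lemma Erf_lipschitz r s : r <= s -> Erf r <= Erf s + (s - r).
Proof.
move=> rs; rewrite -lee_fin EFinD -!normal_tailE.
rewrite (@itv_bndbnd_setU _ _ (BLeft r) (BLeft s))//.
have mu2 : (normal_prob 0 1 (`[r, s[ `|` `[s, +oo[) <=
    normal_prob 0 1 `[r, s[%classic + normal_prob 0 1 `[s, +oo[%classic)%E.
  exact: measureU2.
apply: (le_trans mu2); rewrite addeC; apply: leeD => //.
have -> : (s - r)%:E = (\int[lebesgue_measure]_(x in `[r, s[) (1 : R)%:E)%E.
  by rewrite integral_cst//= mul1e lebesgue_measure_itv/= lte_fin -EFinD; 
    case: ltgtP rs => // -> _; rewrite subrr.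
apply: ge0_le_integral => //=.
- by move=> x _; rewrite lee_fin normal_pdf_ge0.
- by apply/measurable_EFinP/measurable_funTS; exact: measurable_normal_pdf.
- by move=> x _; rewrite lee_fin normal_pdf01_le1.
Qed.

Lemma Erf_antitone r s : r <= s -> Erf s <= Erf r.
Proof.
move=> rs; rewrite -lee_fin -!normal_tailE; apply: le_measure; rewrite ?inE//.
by apply: subset_itvr; rewrite bnd_simp.
Qed.

Lemma Erf0 : Erf 0 = 1 / 2 :> R.
Proof.
have := @integral_normal_pdf R 0 1; rewrite ge0_symfun_integralT.
- rewrite -set_itvcy -/(normal_prob 0 1 `[0, +oo[) normal_tailE -EFinM => -[].
  by move=> h; lra.
- by move=> x; exact: normal_pdf_ge0.
- by apply: continuous_normal_pdf; exact: oner_neq0.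
- move=> x /=; rewrite !normal_pdfE ?oner_neq0//.
  by rewrite /normal_fun !subr0 sqrrN.
Qed.

(* Compare the density with that of the unit normal law centred at s. *)
Lemma Erf_le_expR s : 0 <= s -> Erf s <= expR (- (s ^+ 2 / 2)).
Proof.
move=> s0; rewrite -lee_fin -normal_tailE.
apply: (@le_trans _ _ ((expR (- (s ^+ 2 / 2)))%:E * normal_prob s 1 `[s, +oo[)%E).
  rewrite /normal_prob -ge0_integralZl//=; first last.
  - by move=> x _; rewrite lee_fin normal_pdf_ge0.
  - by apply/measurable_EFinP/measurable_funTS; exact: measurable_normal_pdf.
  apply: ge0_le_integral => //=.
  - by move=> x _; rewrite lee_fin normal_pdf_ge0.
  - by apply/measurable_EFinP/measurable_funTS; exact: measurable_normal_pdf.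
  - apply/measurable_EFinP/measurable_funTS; apply: measurable_funM => //.
    exact: measurable_normal_pdf.
  move=> x; rewrite in_itv/= andbT => sx; rewrite -EFinM lee_fin.
  rewrite !normal_pdfE ?oner_neq0// mulrCA ler_wpM2l ?normal_peak_ge0//.
  rewrite /normal_fun -expRD ler_expR expr1n.
  (* The two exponents differ by exactly s (x - s). *)
  have : 0 <= s * (x - s) by rewrite mulr_ge0// subr_ge0.
  by lra.
rewrite -[leRHS]mule1 lee_wpmul2l ?lee_fin ?expR_ge0//.
exact: probability_le1.
Qed.

End GaussianTail.

(** * Attainment, positivity and monotonicity of [ErfInv] on (0, 1/2) *)

Section GaussianQuantile.
Context {R : realType}.
Implicit Types (r s e : R).

Lemma Erf_lt_half_gt0 r : Erf r < 1 / 2 -> 0 < r.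
Proof.
rewrite ltNge => rh; rewrite ltNge.
by apply: contra rh => /Erf_antitone; rewrite Erf0.
Qed.

(** The point is the one where the bound of [Erf_le_expR] equals e. It shows that the set defining
    [ErfInv] is nonempty and bounds [ErfInv] from above. *)
Lemma Erf_sqrt_ln e : 0 < e < 1 -> Erf (Num.sqrt (- (2 * ln e))) <= e.
Proof.
move=> /andP[e0 e1]; apply: (le_trans (Erf_le_expR (sqrtr_ge0 _))).
have ln0 : ln e < 0 by rewrite ln_lt0// e0.
rewrite sqr_sqrtr; last by lra.
by rewrite (_ : - (- (2 * ln e) / 2) = ln e) ?lnK//; lra.
Qed.

Let has_inf_Erf e : 0 < e < 1 / 2 -> has_inf [set r | Erf r <= e].
Proof.
move=> /andP[e0 e1]; split.
  by exists (Num.sqrt (- (2 * ln e))); apply: Erf_sqrt_ln; lra.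
by exists 0 => r /= re; apply/ltW/Erf_lt_half_gt0; lra.
Qed.

Let ErfInvE e : 0 < e < 1 / 2 -> ErfInv e = inf [set r | Erf r <= e].
Proof. by move=> /andP[e0 e1]; rewrite /ErfInv ltW. Qed.

Lemma ErfInv_le e r : 0 < e < 1 / 2 -> Erf r <= e -> ErfInv e <= r.
Proof.
by move=> he re; rewrite ErfInvE//; apply: ge_inf => //; have [] := has_inf_Erf he.
Qed.

Lemma Erf_ErfInv e : 0 < e < 1 / 2 -> Erf (ErfInv e) <= e.
Proof.
move=> he; apply/ler_addgt0Pr => d d0.
have [r /= re rd] := inf_adherent d0 (has_inf_Erf he).
have := Erf_lipschitz (ErfInv_le he re).
by rewrite -ErfInvE// in rd; lra.
Qed.

Lemma ErfInv_gt0 e : 0 < e < 1 / 2 -> 0 < ErfInv e.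
Proof.
move=> he; have := Erf_ErfInv he; case/andP: he => _ he h.
exact/Erf_lt_half_gt0/(le_lt_trans h).
Qed.

Lemma ErfInv_antitone e e' : 0 < e -> e <= e' -> e' < 1 / 2 ->
  ErfInv e' <= ErfInv e.
Proof.
move=> e0 ee' e1; apply: ErfInv_le; first lra.
by rewrite (le_trans _ ee')// Erf_ErfInv//; lra.
Qed.

(** Serves to show that the sub-Gaussian value of [chi_low] is at least 1. *)
Lemma ErfInv_sqr_le e : 0 < e < 1 / 2 -> ErfInv e ^+ 2 <= - (2 * ln e).
Proof.
move=> he; have e1 : 0 < e < 1 by lra.
have ln0 : ln e < 0 by rewrite ln_lt0.
have := ErfInv_le he (Erf_sqrt_ln e1) => h.
rewrite -(@sqr_sqrtr _ (- (2 * ln e))); last by lra.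
by rewrite lerXn2r// nnegrE ?sqrtr_ge0// ltW// ErfInv_gt0.
Qed.

End GaussianQuantile.

(** * Linear and quadratic forms, and the payoff along a ray *)

Section Forms.
Context {R : realType}.
Variable m : nat.
Implicit Types (g h : 'cV[R]_m) (A : 'M[R]_m).

Lemma dotvDr g h h' : dotv g (h + h') = dotv g h + dotv g h'.
Proof. by rewrite /dotv mulmxDr mxE. Qed.

Lemma dotvZr (c : R) g h : dotv g (c *: h) = c * dotv g h.
Proof. by rewrite /dotv -scalemxAr mxE. Qed.

Lemma dotvNr g h : dotv g (- h) = - dotv g h.
Proof. by rewrite /dotv mulmxN mxE. Qed.

Lemma dotvZl (c : R) g h : dotv (c *: g) h = c * dotv g h.
Proof.
by rewrite /dotv !mxE mulr_sumr; apply: eq_bigr => i _; rewrite !mxE mulrA.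
Qed.

Lemma dotv0l h : dotv 0 h = 0.
Proof. by rewrite /dotv trmx0 mul0mx mxE. Qed.

Lemma dotv0r h : dotv h 0 = 0.
Proof. by rewrite /dotv mulmx0 mxE. Qed.

Lemma dotv_mulmxr l (B : 'M[R]_(m, l)) h (z : 'cV[R]_l) :
  dotv h (B *m z) = dotv (B^T *m h) z.
Proof. by rewrite /dotv trmx_mul trmxK mulmxA. Qed.

Lemma qformZ (c : R) A h : qform A (c *: h) = c ^+ 2 * qform A h.
Proof.
have qE h' : qform A h' = dotv h' (A *m h') by rewrite /qform /dotv mulmxA.
by rewrite !qE dotvZl -scalemxAr dotvZr mulrA expr2.
Qed.

Lemma qform_congr l (B : 'M[R]_(m, l)) (C : 'M[R]_l) h :
  qform (B *m C *m B^T) h = qform C (B^T *m h).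
Proof. by rewrite /qform trmx_mul trmxK !mulmxA. Qed.

Lemma payoffZ (c : R) h th1 th2 A : c != 0 ->
  payoff (c *: h) th1 th2 A =
  c ^+ 2 * payoff h (c^-1 *: th1) (c^-1 *: th2) A.
Proof.
move=> c0; rewrite /payoff dotvZl qformZ -scalerBr dotvZr.
by field.
Qed.

Lemma psd_qform_ge0 A h : int_psd A -> 0 <= qform A h.
Proof. by move=> [sA /nbhs_singleton]/(_ sA)[_]; exact. Qed.

(* The derivative of c |-> payoff (c h) vanishes at its minimum c = 1. *)
Lemma payoff_stationary h th1 th2 A :
  (forall h', payoff h th1 th2 A <= payoff h' th1 th2 A) ->
  dotv h (th2 - th1) = - (2 * qform A h).
Proof.
move=> hmin.
set a := dotv h (th2 - th1); set b := qform A h.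
(* [u] is twice the derivative at c = 1. As [B] exceeds |b| by 1, moving to c = 1 - u / B changes
   the payoff by at most - (u / B)^2 / 2, so minimality forces u = 0. *)
pose u := a + 2 * b; pose B := `|b| + 1.
have B0 : 0 < B by rewrite ltr_wpDl.
have := hmin ((1 - u / B) *: h); rewrite /payoff dotvZl qformZ -/a -/b.
have bb : b * (u / B) ^+ 2 <= `|b| * (u / B) ^+ 2.
  by rewrite ler_wpM2r ?sqr_ge0 ?ler_norm.
have uE : u = u / B * B by rewrite divfK ?gt_eqF.
have := sqr_ge0 (u / B); set v := u / B in bb uE *.
have aE : a = v * B - 2 * b by rewrite -uE /u addrK.
rewrite aE /B => v0 hle.
have v2 : v ^+ 2 <= 0 by lra.
have /eqP -> : v == 0 by rewrite -sqrf_eq0 eq_le v2.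
by ring.
Qed.
End Forms.

(** * Feasible signals and saddle point values as functions of the magnitude *)

Lemma convex_set_scale (R : realType) (M : lmodType R)
    (A : set (convex_lmodType M)) (x : M) (c : R) :
  convex_set A -> A (0 : M) -> A x -> 0 <= c <= 1 -> A (c *: x).
Proof.
move=> cA A0 Ax c01; pose l := Itv01 (andP c01).1 (andP c01).2.
have := cA x 0 l; rewrite !inE => /(_ Ax A0).
by rewrite /conv/= scaler0 addr0.
Qed.

Section SaddleValues.
Context {R : realType}.
Variable p : problem R.
Hypothesis hp : standing_assumptions p.
Local Notation d := (stages p).
Local Notation K := (shapes p).
Implicit Types (t : nat) (k : 'I_K) (rho r c : R).

(** The factor r2 / r1 >= 1 is absorbed by the element of W_k. *)
Lemma signals_antitone k r1 r2 : 0 < r1 -> r1 <= r2 ->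
  signals k r2 `<=` signals k r1.
Proof.
move=> r10 r12 x [[v Vv [_ [w Ww <-] <-]] Xx]; split => //.
exists v => //; exists (r2 *: w) => //; exists ((r2 / r1) *: w).
  by apply: (acts_scale hp) => //; rewrite ler_pdivlMr// mul1r.
by rewrite scalerA mulrC divfK ?gt_eqF.
Qed.

(** The shift and the whole input shrink towards 0 inside the convex sets V_k and X, while the
    element of W_k is kept and the factor goes to the magnitude. That 0 lies in X comes from N. *)
Lemma signals_scale k rho c x : 0 <= c <= 1 ->
  signals k rho x -> signals k (c * rho) (c *: x).
Proof.
move=> c01 [[v Vv [_ [w Ww <-] <-]] Xx]; split; last first.
  apply: convex_set_scale => //; first exact: (inputs_convex hp).
  exact/(nuis_sub hp)/(nuis_0 hp).
exists (c *: v); last first.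
  exists ((c * rho) *: w); first by exists w.
  by rewrite scalerDr scalerA.
by apply: convex_set_scale => //; [exact: (shifts_convex hp)|exact: (shifts_0 hp)].
Qed.

Definition worst_payoff t k rho (h : 'cV[R]_(nu p t)) : \bar R :=
  ereal_sup [set z | exists (th1 th2 : 'cV[R]_(nu p t)) Theta,
    [/\ nuis_at th1, signals_at k rho th2, covs_at Theta
      & z = (payoff h th1 th2 Theta)%:E]].

Lemma SV_le t k rho (h : 'cV[R]_(nu p t)) : (SV t k rho <= worst_payoff k rho h)%E.
Proof. by apply: ereal_inf_lbound; exists h. Qed.

Lemma SV_antitone t k r1 r2 : 0 < r1 -> r1 <= r2 -> (SV t k r2 <= SV t k r1)%E.
Proof.
move=> r10 r12; apply: le_ereal_inf_tmp => _ [h _ <-].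
apply: (le_trans (SV_le _ _ h)).
apply: le_ereal_sup => _ [th1 [th2 [Th [h1 [x Xx <-] hT ->]]]].
exists th1, (Abar p t *m x), Th; split => //; exists x => //.
exact: (signals_antitone r10 r12).
Qed.

(* If h is used at magnitude rho, use c h at magnitude c rho: payoff (c h) at a
   signal is c ^ 2 times payoff h at the signal shrunk by c. *)
Lemma SV_dilate t k rho c : 1 <= c ->
  (SV t k (c * rho) <= (c ^+ 2)%:E * SV t k rho)%E.
Proof.
move=> c1; have c0 : 0 < c by lra.
have ci : 0 <= c^-1 <= 1 by rewrite invr_ge0 ltW//= invf_le1.
rewrite -lee_pdivrMl ?exprn_gt0//; apply: le_ereal_inf_tmp => _ [h _ <-].
rewrite lee_pdivrMl ?exprn_gt0//.
apply: (le_trans (SV_le _ _ (c *: h))).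
apply: ge_ereal_sup => _ [th1 [th2 [Th [[x1 Nx1 <-] [x Xx <-] hT ->]]]].
rewrite payoffZ ?gt_eqF// EFinM lee_pmul2l// ?lte_fin ?exprn_gt0//.
apply: ereal_sup_ubound.
exists (Abar p t *m (c^-1 *: x1)), (Abar p t *m (c^-1 *: x)), Th.
rewrite -!scalemxAr; split => //.
  exists (c^-1 *: x1); last by rewrite -scalemxAr.
  apply: convex_set_scale => //; [exact: (nuis_convex hp)|exact: (nuis_0 hp)].
exists (c^-1 *: x); last by rewrite -scalemxAr.
by have := signals_scale ci Xx; rewrite mulKf// gt_eqF.
Qed.

(** Maximality at h bounds the value from above; minimality in h, with the maximising triple frozen,
    bounds it from below. *)
Lemma saddle_point_SV t k rho (h th1 th2 : 'cV[R]_(nu p t)) Th :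
  saddle_point k rho h th1 th2 Th -> SV t k rho = (payoff h th1 th2 Th)%:E.
Proof.
move=> [N1 S2 CT hmax hmin]; apply/eqP; rewrite eq_le; apply/andP; split.
  apply: (le_trans (SV_le _ _ h)).
  apply: ge_ereal_sup => _ [th1' [th2' [Th' [h1 h2 hT ->]]]].
  by rewrite lee_fin hmax.
apply: le_ereal_inf_tmp => _ [h' _ <-].
apply: (@le_trans _ _ (payoff h' th1 th2 Th)%:E); first by rewrite lee_fin hmin.
by apply: ereal_sup_ubound; exists th1, th2, Th.
Qed.

Lemma le_Rmax k rho x : 0 < Rmax k -> 0 < rho -> signals k rho x -> rho <= Rmax k.
Proof.
move=> R0 rho0 Sx; apply: ub_le_sup; last by split => //; exists x.
(* The supremum of an unbounded set is 0 by default, so 0 < [Rmax k] yields boundedness. *)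
apply: contrapT => nub; move: R0.
by rewrite /Rmax sup_out ?ltxx// => -[].
Qed.

End SaddleValues.

(** * Explicit bounds on [kap_SG] and [delta_G] *)

Section Thresholds.
Context {R : realType}.
Variable p : problem R.
Local Notation d := (stages p).
Local Notation K := (shapes p).
Variables (eps : R) (epst : nat -> R) (t : nat).
Hypothesis heps : 0 < eps < 1 / 2.
Hypothesis ht : (1 <= t <= d)%N.
Hypothesis hepst : epst t = eps / d%:R.
Hypothesis K0 : (0 < K)%N.

Let d_ge1 : 1 <= d%:R :> R.
Proof. by rewrite ler1n; case/andP: ht => h1; exact: leq_trans. Qed.

Let K_ge1 : 1 <= K%:R :> R. Proof. by rewrite ler1n. Qed.

Let eps_Kd : 0 < eps / (K%:R * d%:R) <= eps.
Proof.
have [d1 k1] := (d_ge1, K_ge1).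
have Kd : 1 <= K%:R * d%:R :> R by rewrite -[leLHS]mulr1 ler_pM.
case/andP: heps => e0 _; rewrite divr_gt0//=; last lra.
by rewrite ler_pdivrMr; [rewrite ler_peMr// ltW|lra].
Qed.

(** At this value of kap the bound eps epst / kap^2 equals K, which no cardinality of a set of
    shapes exceeds. *)
Lemma kap_SG_ge : Num.sqrt (eps ^+ 2 / (K%:R * d%:R)) <= kap_SG p eps epst t.
Proof.
have [d1 k1] := (d_ge1, K_ge1).
have Kd : 1 <= K%:R * d%:R :> R by rewrite -[leLHS]mulr1 ler_pM.
case/andP: (heps) => e0 e1.
have s0 : 0 < eps ^+ 2 / (K%:R * d%:R) by rewrite divr_gt0 ?exprn_gt0//; lra.
apply: ub_le_sup; first by exists 1 => z /= [/andP[]].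
split.
  rewrite sqrtr_gt0 s0/= -[leRHS]sqrtr1 ler_wsqrtr//.
  rewrite ler_pdivrMr; last lra.
  by rewrite mul1r (le_trans _ Kd)// expr_le1//; lra.
rewrite sqr_sqrtr; last exact: ltW.
rewrite hepst (_ : eps * (eps / d%:R) / (eps ^+ 2 / (K%:R * d%:R)) = K%:R).
  by rewrite ler_nat /cardK -[leqRHS]card_ord max_card.
by field; rewrite !gt_eqF//; lra.
Qed.

Lemma kap_SG_gt0 : 0 < kap_SG p eps epst t.
Proof.
have [d1 k1] := (d_ge1, K_ge1).
apply: lt_le_trans kap_SG_ge; rewrite sqrtr_gt0 divr_gt0 ?exprn_gt0//.
  by case/andP: heps.
by rewrite mulr_gt0//; lra.
Qed.

Local Notation delta := (delta_G p eps epst t).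

Lemma ErfInvDiv_ge0 (L : nat) : 0 <= ErfInvDiv (epst t) L.
Proof.
rewrite /ErfInvDiv; case: eqP => // /eqP L0.
rewrite ltW// ErfInv_gt0//.
have d1 := d_ge1.
have L1 : 1 <= L%:R :> R by rewrite ler1n lt0n.
case/andP: heps => e0 e1.
rewrite hepst !divr_gt0//=; [|lra..].
rewrite -mulrA -invfM ltr_pdivrMr; last by rewrite mulr_gt0//; lra.
have : 1 <= d%:R * L%:R :> R by rewrite -[leLHS]mulr1 ler_pM.
by nra.
Qed.

Lemma ErfInvDiv_le (L : nat) : (L <= K)%N ->
  ErfInvDiv (epst t) L <= ErfInv (eps / (K%:R * d%:R)).
Proof.
have [d1 k1] := (d_ge1, K_ge1).
move=> LK; case/andP: heps => e0 e1; case/andP: eps_Kd => f0 f1.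
rewrite /ErfInvDiv; case: eqP => [_|/eqP L0].
  by rewrite ltW// ErfInv_gt0//; lra.
have L1 : 1 <= L%:R :> R by rewrite ler1n lt0n.
have dL : 1 <= d%:R * L%:R :> R by rewrite -[leLHS]mulr1 ler_pM.
rewrite hepst -mulrA -invfM.
apply: ErfInv_antitone => //.
  rewrite ler_pM2l// lef_pV2 ?posrE; [|nra|lra].
  by rewrite mulrC ler_wpM2r// ?ler_nat//; lra.
rewrite ltr_pdivrMr; last lra.
by nra.
Qed.

Lemma cardL_le (x : R) : (cardL p t x <= K)%N.
Proof. by rewrite /cardL -[leqRHS]card_ord max_card. Qed.

Let feasible := [set x | 0 <= x /\
    1 / 2 * (ErfInvDiv (epst t) (cardL p t x) + ErfInv eps) <= x].

(** [cardL] never exceeds K, so bounding the quantile term by its value for K gives one explicit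
    feasible point. *)
Let ratio_feasible :
  feasible (1 / 2 * (ErfInv (eps / (K%:R * d%:R)) + ErfInv eps)).
Proof.
case/andP: heps => e0 e1; case/andP: eps_Kd => f0 f1.
have q0 : 0 < ErfInv eps by exact: ErfInv_gt0.
have q1 : ErfInv eps <= ErfInv (eps / (K%:R * d%:R)) by exact: ErfInv_antitone.
split; first by lra.
by rewrite ler_pM2l ?lerD2r ?ErfInvDiv_le ?cardL_le//; lra.
Qed.

Let has_lbound_feasible : has_lbound feasible.
Proof. by exists 0 => x []. Qed.

Lemma delta_G_le : delta <= 1 / 2 * (ErfInv (eps / (K%:R * d%:R)) + ErfInv eps).
Proof. exact: ge_inf. Qed.

Lemma delta_G_ge0 : 0 <= delta.
Proof.
apply: lb_le_inf; last by move=> x [].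
by exists (1 / 2 * (ErfInv (eps / (K%:R * d%:R)) + ErfInv eps)).
Qed.

(* The inequality defining cardL is strict, whence continuity from the right. *)
Lemma cardL_right_const (x : R) : 0 <= x ->
  exists2 e, 0 < e & forall y, x <= y < x + e -> cardL p t y = cardL p t x.
Proof.
move=> x0.
pose f (k : 'I_K) : \bar R := SV t k (Rmax k).
have step k : exists2 e, 0 < e & forall y, x <= y < x + e ->
    (f k < (- (1 / 2 * y ^+ 2))%:E)%E = (f k < (- (1 / 2 * x ^+ 2))%:E)%E.
  have [fx|fx] := ltP (f k) (- (1 / 2 * x ^+ 2))%:E; last first.
    exists 1 => // y /andP[xy _]; apply/negbTE; rewrite -leNgt.
    apply: le_trans fx; rewrite lee_fin lerN2 ler_pM2l; last lra.
    by rewrite lerXn2r ?nnegrE//; lra.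
  (* [f k] may be -oo, so a real [s] between it and the level replaces it; the strict inequality
     then persists up to the [q] with - q^2 / 2 = s. *)
  have [s fs sx] : exists2 s : R, (f k <= s%:E)%E & s < - (1 / 2 * x ^+ 2).
    move: fx; case: (f k) => [s| |]//.
      by rewrite lte_fin; exists s.
    by move=> _; exists (- (1 / 2 * x ^+ 2) - 1); [rewrite leNye|lra].
  pose q := Num.sqrt (- (2 * s)).
  have xq : x < q.
    rewrite -(@ltr_pXn2r _ 2)// ?nnegrE ?sqrtr_ge0//.
    have := sqr_ge0 x => xx.
    by rewrite sqr_sqrtr; lra.
  exists (q - x); first lra.
  move=> y /andP[xy yq]; apply: (le_lt_trans fs); rewrite lte_fin.
  have : y ^+ 2 < q ^+ 2 by rewrite ltr_pXn2r ?nnegrE ?sqrtr_ge0//; lra.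
  have := sqr_ge0 x => xx.
  by rewrite sqr_sqrtr; lra.
have /choice[e he] : forall k, exists e, 0 < e /\ forall y, x <= y < x + e ->
    (f k < (- (1 / 2 * y ^+ 2))%:E)%E = (f k < (- (1 / 2 * x ^+ 2))%:E)%E.
  by move=> k; have [e e0 H] := step k; exists e.
exists (\big[Num.min/1]_k e k).
  apply: (big_rec (fun z : R => 0 < z)) => // k z _ z0.
  by rewrite lt_min z0 (he k).1.
move=> y /andP[xy ye]; apply: eq_card => k; rewrite !inE.
apply: (he k).2; rewrite xy/= (lt_le_trans ye)// lerD2l.
by rewrite (bigD1 k)//= ge_min lexx.
Qed.

(** Feasible points come arbitrarily close to the infimum from the right, where [cardL] already has
    its value at the infimum, so the inequality passes to the limit. *)
Lemma delta_G_feasible :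
  1 / 2 * (ErfInvDiv (epst t) (cardL p t delta) + ErfInv eps) <= delta.
Proof.
have [e e0 he] := cardL_right_const delta_G_ge0.
apply/ler_addgt0Pr => z z0.
have ez : 0 < Num.min e z by rewrite lt_min e0.
have hi : has_inf feasible by split => //; eexists; exact: ratio_feasible.
have [y Fy ylt] := inf_adherent ez hi.
have dy : delta <= y by exact: ge_inf.
rewrite -(he y); last first.
  by rewrite dy (lt_le_trans ylt)// lerD2l ge_min lexx.
apply: (le_trans Fy.2); rewrite ltW// (lt_le_trans ylt)// lerD2l.
by rewrite ge_min lexx orbT.
Qed.

Lemma delta_G_gt0 : 0 < delta.
Proof.
apply: lt_le_trans delta_G_feasible.
have := ErfInv_gt0 heps; have := ErfInvDiv_ge0 (cardL p t delta).
by lra.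
Qed.

End Thresholds.

(** * Tail bounds for linear forms of the noise *)

Lemma lne_le_expR (R : realType) (y : \bar R) (r : R) :
  (lne y <= r%:E)%E -> (y <= (expR r)%:E)%E.
Proof.
case: y => [y| |]//=; last by rewrite !leNye.
have [y0 _|y0] := leP y 0; first by rewrite lee_fin (le_trans y0)// expR_ge0.
by rewrite !lee_fin => h; rewrite -[leLHS]lnK ?posrE// ler_expR.
Qed.

Section NoiseTails.
Context {R : realType} {d0 : measure_display} {Omega : measurableType d0}.
Variables (P : probability Omega R) (m : nat) (xi : 'I_m -> {RV P >-> R}).
Implicit Types (g : 'cV[R]_m) (Theta : 'M[R]_m) (a : R).

Lemma measurable_dotv_rvec g :
  measurable_fun [set: Omega] (fun w => dotv g (rvec xi w)).
Proof.
rewrite (_ : (fun w => _) = (fun w => \sum_i g i 0 * xi i w)).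
  by apply: measurable_sum => i; apply: measurable_funM.
by apply/funext => w; rewrite /dotv !mxE; apply: eq_bigr => i _; rewrite !mxE.
Qed.

Lemma measurable_dotv_rvec_ge g a :
  measurable [set w | a <= dotv g (rvec xi w)].
Proof.
have := measurable_dotv_rvec g measurableT (measurable_itv `[a, +oo[).
rewrite setTI; congr measurable; apply/seteqP; split=> w /=.
  by rewrite in_itv/= andbT.
by rewrite in_itv/= andbT.
Qed.

Lemma sub_gaussian_tail Theta g a : sub_gaussian xi 0 Theta ->
  (P [set w | (a <= dotv g (rvec xi w))%R]
   <= (expR (1 / 2 * qform Theta g - a))%:E)%E.
Proof.
move=> /(_ g); rewrite dotv0l add0r => hg.
pose X : {RV P >-> R} := mfun_Sub (mem_set (measurable_dotv_rvec g)).
(* Parameter 1 suffices in the Chernoff bound, since the saddle point already fixes the scale of the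
   direction. *)
apply: (le_trans (chernoff X a ltr01)).
rewrite /mmt_gen_fun.
rewrite (_ : expR \o 1 \o* X = fun w => expR (dotv g (rvec xi w))); last first.
  by apply/funext => w /=; rewrite mulr1.
rewrite (mul1r a) expRD EFinM; apply: lee_wpmul2r.
  by rewrite lee_fin expR_ge0.
exact: lne_le_expR.
Qed.

Lemma gaussian_tail Theta g a (e delta : R) : gaussian xi 0 Theta ->
  0 < e < 1 / 2 -> 0 < delta -> 0 <= qform Theta g <= delta ^+ 2 ->
  delta * ErfInv e <= a ->
  (P [set w | (a <= dotv g (rvec xi w))%R] <= e%:E)%E.
Proof.
move=> hG he de /andP[v0 vd] ha.
have q0 := ErfInv_gt0 he.
have a0 : 0 < a by apply: lt_le_trans ha; exact: mulr_gt0.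
set v := qform Theta g in v0 vd.
(* With zero variance the law is the Dirac mass at 0, which misses [a, +oo[ because a > 0. *)
have [vz|vn] := eqVneq v 0.
  have := hG g _ (measurable_itv `[a, +oo[).
  rewrite /normal_law -/v vz eqxx dotv0r diracE memNset => [|/=]; last first.
    by rewrite in_itv/= andbT; apply/negP; rewrite -ltNge.
  rewrite (_ : [set w | _] = [set w | (a <= dotv g (rvec xi w))%R]).
    by move=> ->; rewrite lee_fin ltW//; case/andP: he.
  by apply/seteqP; split => w /=; rewrite in_itv/= andbT.
have vp : 0 < v by rewrite lt_neqAle eq_sym vn.
pose c := (Num.sqrt v)^-1.
have sp : 0 < Num.sqrt v by rewrite sqrtr_gt0.
have c0 : 0 < c by rewrite invr_gt0.
have := hG (c *: g) _ (measurable_itv `[c * a, +oo[).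
rewrite /normal_law dotv0r qformZ -/v (_ : c ^+ 2 * v = 1); last first.
  by rewrite /c exprVn sqr_sqrtr// mulVf// gt_eqF.
rewrite oner_eq0 sqrtr1 normal_tailE => h.
rewrite (_ : [set w | _] =
    [set w | `[c * a, +oo[%classic (dotv (c *: g) (rvec xi w))]); last first.
  apply/seteqP; split => w /=; rewrite in_itv/= andbT dotvZl ler_pM2l//.
rewrite h lee_fin (le_trans _ (Erf_ErfInv he))//; apply: Erf_antitone.
(* Since sqrt v <= delta, the standardised threshold a / sqrt v is at least [ErfInv e]. *)
rewrite /c ler_pdivlMl// (le_trans _ ha)// ler_pM2r//.
by rewrite -[leRHS]gtr0_norm// -sqrtr_sqr ler_wsqrtr.
Qed.

End NoiseTails.

(** * From one detector to the probability of a signal conclusion *)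

Section Conclusion.
Context {R : realType} {d0 : measure_display} {Omega : measurableType d0}.
Variables (P : probability Omega R) (p : problem R).
Variable xi : 'I_(nu p (stages p)) -> {RV P >-> R}.
Local Notation d := (stages p).
Local Notation K := (shapes p).
Implicit Types (t : nat) (k : 'I_K) (D : detectors p) (alpha : nat -> R).
Implicit Types (x : 'cV[R]_(input_dim p)) (rho : R).

Lemma phi_obs D t k x (z : 'cV[R]_(nu p d)) :
  phi D k (obs x z t) =
  dotv (dir D t k) (Abar p t *m x - (1 / 2) *: (theta1 D t k + theta2 D t k))
  + dotv ((sens p t)^T *m dir D t k) z.
Proof.
by rewrite /phi /obs mulmxDr mulmxA addrAC dotvDr dotv_mulmxr.
Qed.

(** The least stage with a claim is the one where the procedure stops, so any claim up to t will
    do. *)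
Lemma conclusion_byP D alpha (y : forall t, 'cV[R]_(nu p t)) t :
  conclusion_by D alpha y t <->
  exists s, (1 <= s <= t)%N /\ claims D alpha (y s).
Proof.
split=> [[s [st [_ cs]]]|[s [st cs]]]; first by exists s.
have ex : exists s, (0 < s)%N && `[< claims D alpha (y s) >].
  by exists s; rewrite (andP st).1; apply/asboolP.
have [r /andP[r0 /asboolP cr] rmin] := ex_minnP ex.
exists r; split.
  rewrite r0 (leq_trans (rmin s _)) ?(andP st).2// (andP st).1/=.
  exact/asboolP.
split=> // q q0 qr cq; have := rmin q; rewrite q0 (introT (asboolP _) cq)/=.
by move=> /(_ isT); rewrite leqNgt qr.
Qed.

Lemma measurable_claims D alpha x t :
  measurable [set w | claims D alpha (obs x (rvec xi w) t)].
Proof.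
rewrite (_ : [set w | _] = \bigcup_(k in [set k | (mag D t k < +oo)%E])
    [set w | phi D k (obs x (rvec xi w) t) < alpha t]); last first.
  apply/seteqP; split=> w /= [k]; first by move=> [mk pk]; exists k.
  by move=> mk pk; exists k.
apply: fin_bigcup_measurable; first exact: finite_finset.
move=> k _.
set c := dotv (dir D t k)
  (Abar p t *m x - (1 / 2) *: (theta1 D t k + theta2 D t k)).
rewrite (_ : [set w | _] =
    ~` [set w | alpha t - c <= dotv ((sens p t)^T *m dir D t k) (rvec xi w)]).
  exact/measurableC/measurable_dotv_rvec_ge.
apply/seteqP; split=> w /=; rewrite phi_obs -/c => h.
  by apply/negP; rewrite -ltNge; lra.
by move/negP: h; rewrite -ltNge; lra.
Qed.

(** A single active detector below its threshold at stage t is a claim, so a conclusion by time t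
    fails only inside the event bounded by e. *)
Lemma conclusion_prob D alpha x t k (e : R) : (1 <= t)%N ->
  (mag D t k < +oo)%E ->
  (P [set w | (alpha t <= phi D k (obs x (rvec xi w) t))%R] <= e%:E)%E ->
  ((1 - e)%:E <= P [set w | conclusion_by D alpha (obs x (rvec xi w)) t])%E.
Proof.
move=> t1 mk he.
have mA : measurable [set w | alpha t <= phi D k (obs x (rvec xi w) t)].
  set c := dotv (dir D t k)
    (Abar p t *m x - (1 / 2) *: (theta1 D t k + theta2 D t k)).
  rewrite (_ : [set w | _] =
      [set w | alpha t - c <= dotv ((sens p t)^T *m dir D t k) (rvec xi w)]).
    exact: measurable_dotv_rvec_ge.
  by apply/seteqP; split=> w /=; rewrite phi_obs -/c; lra.
have mC : measurable [set w | conclusion_by D alpha (obs x (rvec xi w)) t].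
  rewrite (_ : [set w | _] = \bigcup_(s in [set s | (1 <= s <= t)%N])
      [set w | claims D alpha (obs x (rvec xi w) s)]).
    by apply: bigcup_measurable => s _; exact: measurable_claims.
  apply/seteqP; split=> w /=.
    by move=> /conclusion_byP[s [st cs]]; exists s.
  by move=> [s st cs]; apply/conclusion_byP; exists s.
apply: (@le_trans _ _ (P (~` [set w | alpha t <= phi D k (obs x (rvec xi w) t)]))).
  by rewrite probability_setC// EFinB leeB.
apply: le_measure; rewrite ?inE//; first exact: measurableC.
move=> w /= /negP; rewrite -ltNge => h.
by apply/conclusion_byP; exists t; rewrite t1 leqnn; split => //; exists k.
Qed.

(** Maximality in the signal argument alone gives h^T A_t x <= h^T th2; subtracting the midpoint
    leaves half of the difference. *)
Lemma saddle_drift t k rho (h th1 th2 : 'cV[R]_(nu p t)) Th x :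
  saddle_point k rho h th1 th2 Th -> signals k rho x ->
  dotv h (Abar p t *m x - (1 / 2) *: (th1 + th2)) <= 1 / 2 * dotv h (th2 - th1).
Proof.
move=> [N1 S2 CT hmax _] Sx.
have := hmax th1 (Abar p t *m x) Th N1 (ex_intro2 _ _ x Sx erefl) CT.
rewrite /payoff !(dotvDr, dotvNr, dotvZr).
by lra.
Qed.

(** Maximality in the covariance argument alone, the two means being kept. *)
Lemma saddle_spread t k rho (h th1 th2 : 'cV[R]_(nu p t)) Th C :
  saddle_point k rho h th1 th2 Th -> covs p C ->
  qform C ((sens p t)^T *m h) <= qform Th h.
Proof.
move=> [N1 S2 CT hmax _] hC.
have := hmax th1 th2 _ N1 S2 (ex_intro2 _ _ C hC erefl).
by rewrite /payoff qform_congr; lra.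
Qed.

End Conclusion.

Theorem proposition3p4 (R : realType) (c : noise_case) (p : problem R)
  (hp : standing_assumptions p)
  (d0 : measure_display) (Omega : measurableType d0) (P : probability Omega R)
  (xi : 'I_(nu p (stages p)) -> {RV P >-> R}) (hxi : noise_model c xi)
  (eps : R) (heps : 0 < eps < 1 / 2)
  (epst : nat -> R)
  (hepst : forall t, (1 <= t <= stages p)%N -> epst t = eps / (stages p)%:R)
  (D : detectors p) (hD : valid_detectors c eps epst D)
  (t : nat) (ht : (1 <= t <= stages p)%N) (k : 'I_(shapes p))
  (hSV : (SV t k (Rmax k) <= (- (1 / 2 * ErfInv eps ^+ 2))%:E)%E)
  (rhostar : R) (hrho : 0 < rhostar < Rmax k)
  (hSVrho : SV t k rhostar = (- (1 / 2 * ErfInv eps ^+ 2))%:E)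
  (chi : R) (hchi : chi_low c p eps < chi)
  (x : 'cV[R]_(input_dim p))
  (hx : exists2 rho : R, chi * rhostar <= rho & signals k rho x) :
  ((1 - eps)%:E <=
   P [set w | conclusion_by D (threshold c p eps epst) (obs x (rvec xi w)) t])%E.
Proof.
have K0 : (0 < shapes p)%N.
  by case: k {hSV hrho hSVrho hx} => k; exact: leq_ltn_trans.
have [eps0 eps1] := andP heps; have [rs0 rsR] := andP hrho.
have q0 := ErfInv_gt0 heps.
have hepst_t := hepst t ht.
have D1 : 1 <= (stages p)%:R :> R.
  by rewrite ler1n; case/andP: ht => h1; exact: leq_trans.
have K1 : 1 <= (shapes p)%:R :> R by rewrite ler1n.
set Kd : R := (shapes p)%:R * (stages p)%:R.
have Kd1 : 1 <= Kd by rewrite -[leLHS]mulr1 ler_pM.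
have eKd : 0 < eps / Kd <= eps.
  rewrite divr_gt0//=; last lra.
  by rewrite ler_pdivrMr; [rewrite ler_peMr// ltW|lra].
have [rho chirho Sx] := hx.
(* [s] stands for the level defining rho_tk. Dilation by [chi] brings the value at [chi * rhostar]
   below [s]; hence shape k is active and every magnitude at level [s] is at most
   [chi * rhostar]. *)
have reach (s : R) : 1 <= chi -> - (1 / 2 * (chi * ErfInv eps) ^+ 2) < s ->
    (SV t k (Rmax k) < s%:E)%E /\
    forall r, 0 < r -> SV t k r = s%:E -> signals k r x.
  move=> chi1 chis.
  have crs0 : 0 < chi * rhostar by rewrite mulr_gt0//; lra.
  have rho0 : 0 < rho by lra.
  have SVchi : (SV t k (chi * rhostar) < s%:E)%E.
    apply: (le_lt_trans (SV_dilate hp t k rhostar chi1)).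
    by rewrite hSVrho -EFinM lte_fin; move: chis; rewrite exprMn; lra.
  have R0 : 0 < Rmax k by lra.
  split.
    apply: le_lt_trans SVchi; apply: (SV_antitone hp) => //.
    exact/(le_trans chirho)/(le_Rmax R0 rho0 Sx).
  move=> r r0 SVr; apply: (signals_antitone hp r0 _ Sx).
  apply: le_trans chirho; rewrite leNgt; apply/negP => /ltW rchi.
  have := SV_antitone hp t k crs0 rchi; rewrite SVr.
  by rewrite leNgt SVchi.
have t1 : (1 <= t)%N by case/andP: ht.
case: c hxi hD hchi => -[C [hC hnoise]] hD hchi.
- have lnE : ln (Kd / eps ^+ 2) = ln Kd - 2 * ln eps.
    by rewrite ln_div ?posrE ?exprn_gt0//; [rewrite lnXn// mulr_natl|lra].
  have lnKd : 0 <= ln Kd by exact: ln_ge0.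
  have chi_low1 : 1 <= chi_low SubGaussianCase p eps.
    rewrite /= -/Kd ler_pdivlMr ?exprn_gt0// mul1r.
    by rewrite (le_trans (ErfInv_sqr_le heps))// lnE; lra.
  have chi1 : 1 <= chi by lra.
  have kap0 := kap_SG_gt0 heps ht hepst_t K0.
  have lnkap : 1 / 2 * (2 * ln eps - ln Kd) <= ln (kap_SG p eps epst t).
    have s0 : 0 < eps ^+ 2 / Kd by rewrite divr_gt0 ?exprn_gt0//; lra.
    have sq0 : 0 < Num.sqrt (eps ^+ 2 / Kd) by rewrite sqrtr_gt0.
    have /(le_trans _) : ln (Num.sqrt (eps ^+ 2 / Kd)) <= ln (kap_SG p eps epst t).
      by rewrite ler_ln ?posrE//; exact: kap_SG_ge.
    apply.
    have : 2 * ln (Num.sqrt (eps ^+ 2 / Kd)) = ln (eps ^+ 2 / Kd).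
      by rewrite mulr_natl -lnXn// sqr_sqrtr// ltW.
    rewrite ln_div ?posrE ?exprn_gt0//; [rewrite lnXn// -mulr_natl|]; lra.
  have [] := reach (ln (kap_SG p eps epst t)) chi1.
    (* [chi] enters squared through the dilation but only linearly in its lower bound; 1 <= chi
       bridges the two. *)
    move: hchi; rewrite /= -/Kd ltr_pdivrMr ?exprn_gt0// lnE exprMn => hchi.
    have : chi * ErfInv eps ^+ 2 <= chi ^+ 2 * ErfInv eps ^+ 2.
      by rewrite ler_wpM2r ?sqr_ge0// expr2 ler_peMl//; lra.
    by lra.
  move=> SVR reachx; have := hD t k ht; rewrite SVR.
  move=> -[r [mr /andP[r0 _] SVr sad]].
  have Sxr := reachx r r0 SVr.
  apply: (conclusion_prob (k := k) t1); first by rewrite mr ltry.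
  have drift := saddle_drift sad Sxr; have spread := saddle_spread sad hC.
  set b := dotv _ _ in drift.
  rewrite (_ : [set w | _] = [set w | alpha_SG p eps epst t - b <=
      dotv ((sens p t)^T *m dir D t k) (rvec xi w)]); last first.
    by apply/seteqP; split=> w /=; rewrite phi_obs -/b; lra.
  apply: (le_trans (sub_gaussian_tail _ _ hnoise)); rewrite lee_fin.
  rewrite -[leRHS]lnK ?posrE// ler_expR /alpha_SG ln_div ?posrE//.
  (* The Chernoff exponent is at most the saddle value minus the threshold, ln kap - ln (kap / eps)
     = ln eps. *)
  have := saddle_point_SV sad; rewrite SVr => -[]; rewrite /payoff => E.
  by lra.
have ratio1 : ErfInv eps <= ErfInv (eps / Kd).
  by case/andP: eKd => e1 e2; exact: ErfInv_antitone.
set ratio := 1 / 2 * (1 + ErfInv (eps / Kd) / ErfInv eps).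
have rE : ratio * ErfInv eps = 1 / 2 * (ErfInv (eps / Kd) + ErfInv eps).
  by rewrite /ratio; field; rewrite gt_eqF.
have r1 : 1 <= ratio.
  by rewrite -(ler_pM2r q0) rE mul1r; lra.
(* As 1 <= ratio <= ratio^2, this bound covers both Gaussian cases at once. *)
have ratio_chi : ratio < chi.
  move: hchi; rewrite /chi_low -/Kd -/ratio; case: ifP => // _.
  by apply: le_lt_trans; rewrite expr2 ler_peMl//; lra.
set delta := delta_G p eps epst t.
have delta0 : 0 < delta by exact: delta_G_gt0.
have deltale : delta <= ratio * ErfInv eps by rewrite rE; exact: delta_G_le.
have chi1 : 1 <= chi by lra.
have [] := reach (- (1 / 2 * delta ^+ 2)) chi1.
  rewrite ltrN2 ltr_pM2l; last lra.
  rewrite ltr_pXn2r ?nnegrE// ?mulr_ge0//; [|lra..].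
  by rewrite (le_lt_trans deltale)// ltr_pM2r.
move=> SVR reachx; have := hD t k ht; rewrite -/delta SVR.
move=> -[r [mr /andP[r0 _] SVr sad]].
have Sxr := reachx r r0 SVr.
apply: (conclusion_prob (k := k) t1); first by rewrite mr ltry.
have drift := saddle_drift sad Sxr; have spread := saddle_spread sad hC.
set b := dotv _ _ in drift.
rewrite (_ : [set w | _] = [set w | alpha_G p eps epst t - b <=
    dotv ((sens p t)^T *m dir D t k) (rvec xi w)]); last first.
  by apply/seteqP; split=> w /=; rewrite phi_obs -/b; lra.
have := saddle_point_SV sad; rewrite SVr => -[]; rewrite /payoff.
(* Stationarity turns the saddle value into - qform Th h / 2, so the variance at the saddle point is
   delta^2 and the drift is at most - delta^2. *)
have [_ _ _ _ hmin] := sad; have stat := payoff_stationary hmin => E.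
apply: (gaussian_tail hnoise heps delta0).
  rewrite psd_qform_ge0/=; last exact: (covs_int hp).
  by apply: (le_trans spread); lra.
rewrite /alpha_G -/delta.
have feas := delta_G_feasible heps ht hepst_t K0; rewrite -/delta in feas.
set e := ErfInvDiv _ _ in feas *.
(* Feasibility of delta, multiplied by delta, is exactly delta q <= alpha_t + delta^2 with q =
   [ErfInv eps], the threshold that the tail bound asks for. *)
have : delta * (1 / 2 * (e + ErfInv eps)) <= delta * delta by rewrite ler_pM2l.
by rewrite -expr2; lra.
Qed.
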